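(* Let $T$ be a connected strongly graded $S$-ring, $P\subseteq T$ an $S$-subbimodule, and $D(P)=T[z]/\langle P^*\rangle$ the central extension associated to $P$. For $n\in\mathbb N$, the Jacobi relation $$P_{n+1}\cap T^{\le n}\subseteq P_n$$ holds if and only if $\operatorname{ann}(z)^n=0$, where $\operatorname{ann}(z)^n$ is the homogeneous component of degree $n$ of the annihilator of (the class of) $z$ in $D(P)$.
   Context: $S$ is an associative unital ring. A positively graded $S$-ring $T=\bigoplus_{n\ge0}T^n$ is connected if $T^0=S$ and strongly graded if $T^nT^m=T^{n+m}$ for all $n,m$. Put $T^{\le n}=\bigoplus_{m\le n}T^m$, $X^{\le n}=X\cap T^{\le n}$; $\langle X\rangle$ denotes the two-sided ideal generated by $X$. For an $S$-subbimodule $P\subseteq T$ put $P_n:=\sum_{i+j+k=n}T^{\le i}\cdot P^{\le j}\cdot T^{\le k}$. $T[z]$ is the polynomial ring in a central variable $z$, graded by $T[z]^n=\sum_{i=0}^nT^iz^{n-i}$. The external homogenization of $a=\sum_{i=0}^da_i\in T$ with $a_i\in T^i$, $a_d\ne0$, is $a^*=\sum_{i=0}^da_iz^{d-i}\in T[z]^d$ (and $0^*=0$); $P^*=\{x^*\mid x\in P\}$. The class of $z$ in the graded ring $D(P)$ is a central homogeneous element of degree $1$, also denoted $z$, and $\operatorname{ann}(z)=\{a\in D(P)\mid za=0\}$ is a graded ideal. *)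

(* Defs.v *)
From HB Require Import structures.
From mathcomp Require Import all_boot all_algebra.
From mathcomp Require Import boolp classical_sets.

Set Implicit Arguments.
Unset Strict Implicit.
Unset Printing Implicit Defensive.

Import GRing.Theory.
Local Open Scope classical_set_scope.
Local Open Scope ring_scope.
Local Open Scope quotient_scope.

Definition additive_subgroup (V : zmodType) (A : set V) : Prop :=
  A 0 /\ forall x y, A x -> A y -> A (x - y).

Definition add_span (V : zmodType) (X : set V) : set V :=
  smallest (@additive_subgroup V) X.

(* The product of two additive subgroups: finite sums of products [a * b]. *)
Definition mul_span (R : pzRingType) (A B : set R) : set R :=
  add_span [set a * b | a in A & b in B].

Definition two_sided_ideal (R : pzRingType) (I : set R) : Prop :=
  additive_subgroup I /\ forall r x, I x -> I (r * x) /\ I (x * r).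

Definition ideal_span (R : pzRingType) (X : set R) : set R :=
  smallest (@two_sided_ideal R) X.

(* MathComp only equips quotients of commutative rings with a ring structure.
   The quotient by a two-sided ideal is a [pzRingType] since the ideal may be
   the whole ring. *)
Section QuotientRing.
Variables (R : pzRingType) (X : set R).

Lemma ideal_span_ideal : two_sided_ideal (ideal_span X).
Proof.
split; first split.
- by move=> I [[[I0 _] _] _].
- move=> x y Ix Iy I hI.
  by case: (hI) => [[[_ IB] _] _]; apply: IB; [exact: Ix|exact: Iy].
- move=> r x Ix; split=> I hI; case: (hI) => [[_ IM] _].
    by have [] := IM r x (Ix I hI).
  by have [] := IM r x (Ix I hI).
Qed.

Definition ideal_pred : {pred R} := fun x => `[< ideal_span X x >].

Lemma ideal_predP x : reflect (ideal_span X x) (x \in ideal_pred).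
Proof. exact: asboolP. Qed.

Lemma ideal_pred_zmod_closed : zmod_closed ideal_pred.
Proof.
have [[I0 IB] _] := ideal_span_ideal; split; first by apply/ideal_predP.
by move=> x y /ideal_predP Ix /ideal_predP Iy; apply/ideal_predP; apply: IB.
Qed.

HB.instance Definition _ :=
  GRing.isZmodClosed.Build R ideal_pred ideal_pred_zmod_closed.

Definition quotient_ring := Quotient.quot (ideal_pred : zmodClosed R).
HB.instance Definition _ := GRing.Zmodule.on quotient_ring.

Definition class_of : R -> quotient_ring := \pi_quotient_ring.

Lemma class_of_eq x y : class_of x = class_of y <-> ideal_span X (x - y).
Proof.
have E := Quotient.idealrBE (ideal_pred : zmodClosed R) x y.
split=> [/eqP h|h]; first by apply/ideal_predP; rewrite E.
by apply/eqP; rewrite -[_ == _]E; apply/ideal_predP.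
Qed.

Lemma class_ofB x y : class_of (x - y) = class_of x - class_of y.
Proof. exact: (raddfB \pi_(Quotient.quot (ideal_pred : zmodClosed R))). Qed.

Lemma class_ofD x y : class_of (x + y) = class_of x + class_of y.
Proof. exact: (raddfD \pi_(Quotient.quot (ideal_pred : zmodClosed R))). Qed.

Definition quotient_one : quotient_ring := class_of 1.
Definition quotient_mul (x y : quotient_ring) : quotient_ring :=
  class_of (repr x * repr y).

Lemma class_of_repr (x : quotient_ring) : class_of (repr x) = x.
Proof. exact: reprK. Qed.

Lemma quotient_mulE x y :
  quotient_mul (class_of x) (class_of y) = class_of (x * y).
Proof.
have [[_ IB] IM] := ideal_span_ideal.
apply/class_of_eq; set x' := repr _; set y' := repr _.
have hx : ideal_span X (x' - x) by apply/class_of_eq; rewrite class_of_repr.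
have hy : ideal_span X (y - y') by apply/class_of_eq; rewrite class_of_repr.
have -> : x' * y' - x * y = (x' - x) * y' - x * (y - y').
  by rewrite mulrBl mulrBr opprB addrA subrK.
by apply: IB; [have [] := IM y' _ hx|have [] := IM x _ hy].
Qed.

Lemma quotient_mulA : associative quotient_mul.
Proof.
move=> x y z; rewrite -[x]class_of_repr -[y]class_of_repr -[z]class_of_repr.
by rewrite !quotient_mulE mulrA.
Qed.

Lemma quotient_mul1l : left_id quotient_one quotient_mul.
Proof. by move=> x; rewrite -[x]class_of_repr quotient_mulE mul1r. Qed.

Lemma quotient_mul1r : right_id quotient_one quotient_mul.
Proof. by move=> x; rewrite -[x]class_of_repr quotient_mulE mulr1. Qed.

Lemma quotient_mulDl : left_distributive quotient_mul +%R.
Proof.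
move=> x y z; rewrite -[x]class_of_repr -[y]class_of_repr -[z]class_of_repr.
by rewrite -class_ofD !quotient_mulE mulrDl class_ofD.
Qed.

Lemma quotient_mulDr : right_distributive quotient_mul +%R.
Proof.
move=> x y z; rewrite -[x]class_of_repr -[y]class_of_repr -[z]class_of_repr.
by rewrite -class_ofD !quotient_mulE mulrDr class_ofD.
Qed.

HB.instance Definition _ := GRing.Zmodule_isPzRing.Build quotient_ring
  quotient_mulA quotient_mul1l quotient_mul1r quotient_mulDl quotient_mulDr.

Lemma class_of_zmod_morphism : zmod_morphism class_of.
Proof. exact: class_ofB. Qed.

Lemma class_of_monoid_morphism : monoid_morphism class_of.
Proof. by split=> // x y; rewrite -quotient_mulE. Qed.

HB.instance Definition _ :=
  GRing.isZmodMorphism.Build R quotient_ring class_of class_of_zmod_morphism.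
HB.instance Definition _ :=
  GRing.isMonoidMorphism.Build R quotient_ring class_of
    class_of_monoid_morphism.

End QuotientRing.

Section GradedRings.
Variables (S T : nzRingType) (iota : {rmorphism S -> T}).
Variables (Tg : nat -> set T) (P : set T).

Definition homogeneous_family (c : nat -> T) : Prop := forall i, Tg i (c i).

Definition filtration (n : nat) : set T :=
  [set \sum_(i < n.+1) c i | c in homogeneous_family].

(* [T] is a ring over [S] via [iota], with [T] the internal direct sum of the
   subgroups [Tg n] (the [S]-bimodule structure of [Tg n] follows from
   [graded_base] and [graded_mul]). *)
Record graded_over : Prop := GradedOver {
  graded_subgroup : forall n, additive_subgroup (Tg n);
  graded_cover : forall x, exists n, filtration n x;
  graded_direct : forall c n, homogeneous_family c ->
    \sum_(i < n.+1) c i = 0 -> forall i, (i <= n)%N -> c i = 0;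
  graded_base : forall s, Tg 0 (iota s);
  graded_mul : forall m n x y, Tg m x -> Tg n y -> Tg (m + n)%N (x * y)
}.

Definition connected_grading : Prop := injective iota /\ range iota = Tg 0.

Definition strongly_graded : Prop :=
  forall n m, mul_span (Tg n) (Tg m) = Tg (n + m)%N.

Definition subbimodule : Prop :=
  additive_subgroup P /\
  forall s x, P x -> P (iota s * x) /\ P (x * iota s).

Definition filtered_part (n : nat) : set T :=
  add_span [set x | exists i j k, (i + j + k = n)%N /\
    mul_span (mul_span (filtration i) (P `&` filtration j)) (filtration k) x].

Definition homogenize (c : nat -> T) (d : nat) : {poly T} :=
  \sum_(i < d.+1) (c i)%:P * 'X^(d - i).

Definition poly_component (n : nat) : set {poly T} :=
  [set homogenize c n | c in homogeneous_family].

(* The graph of [a |-> a^*], a function by [homogenization_unique] below; the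
   values of [c] beyond [d] are irrelevant. *)
Definition is_homogenization (a : T) (q : {poly T}) : Prop :=
  (a = 0 /\ q = 0) \/
  exists c d, [/\ homogeneous_family c, c d != 0,
    a = \sum_(i < d.+1) c i & q = homogenize c d].

Definition homogenizations : set {poly T} :=
  [set q | exists2 x, P x & is_homogenization x q].

Definition central_extension : pzRingType := quotient_ring homogenizations.

Definition to_central_extension : {poly T} -> central_extension :=
  @class_of _ homogenizations.

Definition ext_z : central_extension := to_central_extension 'X.

Definition ext_component (n : nat) : set central_extension :=
  to_central_extension @` poly_component n.

Definition ann_z : set central_extension := [set a | ext_z * a = 0].

Definition ann_z_component (n : nat) : set central_extension :=
  ann_z `&` ext_component n.

Lemma homogenization_unique : graded_over ->
  forall a, exists! q, is_homogenization a q.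
Proof.
move=> gT a.
have uniq0 c d : homogeneous_family c -> c d != 0 ->
    \sum_(i < d.+1) c i <> 0.
  by move=> hc cd0 s0; case/eqP: cd0; apply: (graded_direct gT hc s0).
have [->|a0] := eqVneq a 0.
  exists 0; split; first by left.
  by move=> q [[_ ->]//|[c [d [hc cd0 /esym/(uniq0 c d hc cd0)]]]].
have [n [c hc ac]] := graded_cover gT a.
have [d hd [cd0 ad]] : exists2 d, (d <= n)%N & c d != 0 /\ a = \sum_(i < d.+1) c i.
  elim: n ac => [|n IH] ac.
    by exists 0; rewrite // -ac; split=> //; move: a0; rewrite -ac big_ord1.
  have [c0|c0] := eqVneq (c n.+1) 0; last by exists n.+1.
  have [|d dn hd] := IH; first by move: ac; rewrite big_ord_recr /= c0 addr0.
  by exists d => //; apply: leqW.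
exists (homogenize c d); split; first by right; exists c, d.
move=> q [[/eqP]|]; first by rewrite (negPf a0).
move=> [c' [d' [hc' cd' ad' ->]]].
pose trunc (f : nat -> T) k i := if (i <= k)%N then f i else 0.
have sumtr f k m : (k <= m)%N ->
    \sum_(i < m.+1) trunc f k i = \sum_(i < k.+1) f i.
  move=> km; rewrite [RHS](big_ord_widen m.+1) ?ltnS // [RHS]big_mkcond /=.
  by apply: eq_bigr => i _; rewrite /trunc ltnS.
have eqtr i : trunc c d i = trunc c' d' i.
  set m := maxn i (maxn d d').
  apply/eqP; rewrite -subr_eq0; apply/eqP.
  apply: (graded_direct gT (c := fun i => trunc c d i - trunc c' d' i) (n := m)).
  - move=> j; have [T0 TB] := graded_subgroup gT j.
    by apply: TB; rewrite /trunc; case: ifP.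
  - by rewrite sumrB !sumtr ?/m ?leq_max ?leqnn ?orbT // -ad -ad' subrr.
  - by rewrite /m leq_max leqnn.
have dd' : d = d'.
  apply/eqP; rewrite eqn_leq; apply/andP; split; rewrite leqNgt; apply/negP=> lt.
    by move: (eqtr d) cd0; rewrite /trunc leqnn leqNgt lt /= => ->; rewrite eqxx.
  by move: (eqtr d') cd'; rewrite /trunc leqnn leqNgt lt /= => <-; rewrite eqxx.
subst d'; apply: eq_bigr => i _.
by have := eqtr i; rewrite /trunc -ltnS ltn_ord => ->.
Qed.

End GradedRings.

Arguments to_central_extension {T} Tg P q.
Arguments ext_z {T} Tg P.
Arguments ext_component {T} Tg P n.
Arguments ann_z {T} Tg P.
Arguments ann_z_component {T} Tg P n.

(* Main.v *)
Require Import Defs.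
From mathcomp Require Import all_boot all_algebra.
From mathcomp Require Import boolp classical_sets zify.

Set Implicit Arguments.
Unset Strict Implicit.
Unset Printing Implicit Defensive.

Import GRing.Theory.
Local Open Scope classical_set_scope.
Local Open Scope ring_scope.

(** Evaluation at [z = 1] restricts to a bijection from [T[z]^n] onto the
    filtration step [T^{<=n}], compatible with products, and it sends [f] and
    [z f] to the same element.  Under it the degree-[n] part of the graded ideal
    [<P^*>] corresponds to [P_n].  Hence [f] in [T[z]^n] represents an element
    of [ann(z)^n] iff [f(1)] lies in [P_{n+1}], and represents [0] iff [f(1)]
    lies in [P_n]. *)

(** * Additive subgroups and additive spans *)

Section AdditiveSubgroups.
Variable V : zmodType.
Implicit Types A X : set V.

Lemma subgroup0 A : additive_subgroup A -> A 0.
Proof. by case. Qed.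

Lemma subgroupB A x y : additive_subgroup A -> A x -> A y -> A (x - y).
Proof. by case=> _; apply. Qed.

Lemma subgroupD A x y : additive_subgroup A -> A x -> A y -> A (x + y).
Proof.
move=> hA Ax Ay; rewrite -[y]opprK -[- y]sub0r.
by do 2?[apply: subgroupB => //]; apply: subgroup0.
Qed.

Lemma subgroup_sum A (I : Type) (r : seq I) (Q : pred I) (F : I -> V) :
  additive_subgroup A -> (forall i, Q i -> A (F i)) ->
  A (\sum_(i <- r | Q i) F i).
Proof.
move=> hA hF; apply: (big_ind A) => //; first exact: subgroup0.
by move=> x y; apply: subgroupD.
Qed.

Lemma add_span_subgroup X : additive_subgroup (add_span X).
Proof.
split=> [B [[]]//|x y hx hy B [hB XB]].
by apply: subgroupB => //; [apply: hx|apply: hy].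
Qed.

Lemma sub_add_span X : X `<=` add_span X.
Proof. by move=> x Xx B [_]; apply. Qed.

Lemma add_span_min X A : additive_subgroup A -> X `<=` A -> add_span X `<=` A.
Proof. by move=> hA XA x; apply. Qed.

(** Turns [add_span_min] into an induction principle: to show that an additive map carries a span
    into [A], it suffices to look at the generators. *)
Lemma preim_subgroup (W : zmodType) (f : W -> V) A :
  zmod_morphism f -> additive_subgroup A -> additive_subgroup (f @^-1` A).
Proof.
move=> fB hA; split=> [|x y Ax Ay] /=; last by rewrite fB; apply: subgroupB.
by rewrite -(subrr 0) fB subrr; apply: subgroup0.
Qed.

End AdditiveSubgroups.

Lemma preim_mull_subgroup (R : pzRingType) (a : R) (A : set R) :
  additive_subgroup A -> additive_subgroup [set x | A (a * x)].
Proof. by apply: (preim_subgroup (f := fun x => a * x)) => x y; rewrite mulrBr. Qed.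

Lemma preim_mulr_subgroup (R : pzRingType) (a : R) (A : set R) :
  additive_subgroup A -> additive_subgroup [set x | A (x * a)].
Proof. by apply: (preim_subgroup (f := fun x => x * a)) => x y; rewrite mulrBl. Qed.

Lemma mul_span_mul (R : pzRingType) (A B : set R) a b :
  A a -> B b -> mul_span A B (a * b).
Proof. by move=> Aa Bb; apply: sub_add_span; exists a => //; exists b. Qed.

(** * Two-sided ideals and vanishing in the quotient ring *)

Section IdealSpan.
Variables (R : pzRingType) (X : set R).

Lemma sub_ideal_span : X `<=` ideal_span X.
Proof. by move=> x Xx B [_]; apply. Qed.

Lemma ideal_span_subgroup : additive_subgroup (ideal_span X).
Proof. by have [] := ideal_span_ideal X. Qed.

Lemma ideal_span_mull r x : ideal_span X x -> ideal_span X (r * x).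
Proof. by have [_ h] := ideal_span_ideal X => /(h r)[]. Qed.

Lemma ideal_span_mulr r x : ideal_span X x -> ideal_span X (x * r).
Proof. by have [_ h] := ideal_span_ideal X => /(h r)[]. Qed.

Lemma class_of_eq0 x : Defs.class_of X x = 0 <-> ideal_span X x.
Proof.
rewrite -(raddf0 (Defs.class_of X)).
by split=> [/class_of_eq|h]; [|apply/class_of_eq]; rewrite subr0.
Qed.

End IdealSpan.

Lemma horner1M (T : nzRingType) (f g : {poly T}) :
  (f * g).[1] = f.[1] * g.[1].
Proof. by rewrite hornerM_comm // /comm_poly mul1r mulr1. Qed.

(** * Homogeneous elements of [T[z]] and evaluation at [z = 1] *)

Section Graded.
Variables (S T : nzRingType) (iota : {rmorphism S -> T}) (Tg : nat -> set T).
Hypothesis hT : graded_over iota Tg.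
Implicit Types (c : nat -> T) (f g : {poly T}).

Let TgA n : additive_subgroup (Tg n) := graded_subgroup hT n.

Lemma homogenizeE c d :
  homogenize c d = \poly_(k < d.+1) c (d - k)%N.
Proof.
rewrite /homogenize poly_def (reindex_inj rev_ord_inj) /=.
apply: eq_bigr => k _.
by rewrite subSS subKn ?mul_polyC // -ltnS.
Qed.

Lemma horner1_homogenize c d : (homogenize c d).[1] = \sum_(i < d.+1) c i.
Proof.
rewrite horner_sum; apply: eq_bigr => i _.
by rewrite horner1M hornerC hornerXn expr1n mulr1.
Qed.

(** Vanishing above [n] has to be stated separately: there the truncated difference [n - k] is [0]
    and would only place the coefficient in [Tg 0]. *)
Lemma poly_componentP n f :
  poly_component Tg n f <->
  forall k, if (k <= n)%N then Tg (n - k)%N f`_k else f`_k = 0.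
Proof.
split=> [[c hc <-] k|hf].
  by rewrite homogenizeE coef_poly ltnS; case: leqP => // _; apply: hc.
exists (fun i => if (i <= n)%N then f`_(n - i) else 0).
  move=> i /=; case: leqP => hi; last exact: subgroup0.
  by have := hf (n - i)%N; rewrite leq_subr subKn.
rewrite homogenizeE; apply/polyP => k; rewrite coef_poly ltnS leq_subr.
by have := hf k; case: leqP => // kn _; rewrite subKn.
Qed.

Lemma poly_component_subgroup n : additive_subgroup (poly_component Tg n).
Proof.
split=> [|f g /poly_componentP hf /poly_componentP hg].
  by apply/poly_componentP => k; rewrite coef0; case: ifP => // _; apply: subgroup0.
apply/poly_componentP => k; have := hf k; have := hg k; rewrite coefB.
by case: ifP => // _ => [|-> ->]; [move=> *; apply: subgroupB|rewrite subrr].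
Qed.

Lemma poly_componentM m n f g :
  poly_component Tg m f -> poly_component Tg n g ->
  poly_component Tg (m + n) (f * g).
Proof.
move=> /poly_componentP hf /poly_componentP hg; apply/poly_componentP => k.
rewrite coefM; case: leqP => hk.
  apply: subgroup_sum => // -[j /= jk] _; have := hf j; have := hg (k - j)%N.
  case: leqP => hn; last by move=> -> _; rewrite mulr0; apply: subgroup0.
  case: leqP => hm; last by move=> _ ->; rewrite mul0r; apply: subgroup0.
  move=> hgk hfj; have := graded_mul hT hfj hgk.
  by have -> : (m - j + (n - (k - j)) = m + n - k)%N by lia.
(* Now [k > m + n], so [j <= m] and [k - j <= n] cannot both hold, and each term has a zero
   factor. *)
apply: big1 => -[j /= jk] _; have := hf j; have := hg (k - j)%N.
case: leqP => hn; last by move=> -> _; rewrite mulr0.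
case: leqP => hm; last by move=> _ ->; rewrite mul0r.
by move: (leq_add hm hn); rewrite subnKC // leqNgt hk.
Qed.

Lemma poly_componentX : poly_component Tg 1 'X.
Proof.
apply/poly_componentP => -[|[|k]] //; rewrite coefX //=.
  exact: subgroup0.
by rewrite -(rmorph1 iota); apply: graded_base hT _.
Qed.

Lemma poly_component1 : poly_component Tg 0 1.
Proof.
apply/poly_componentP => -[|k]; rewrite coef1 //=.
by rewrite -(rmorph1 iota); apply: graded_base hT _.
Qed.

Lemma filtrationP n x :
  filtration Tg n x <-> exists2 f, poly_component Tg n f & f.[1] = x.
Proof.
split=> [[c hc <-]|[_ [c hc <-] <-]].
  by exists (homogenize c n); [exists c|rewrite horner1_homogenize].
by exists c; rewrite ?horner1_homogenize.
Qed.

Lemma filtrationM m n x y :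
  filtration Tg m x -> filtration Tg n y -> filtration Tg (m + n) (x * y).
Proof.
move=> /filtrationP[f hf <-] /filtrationP[g hg <-]; apply/filtrationP.
by exists (f * g); [apply: poly_componentM|rewrite horner1M].
Qed.

Lemma filtration1 : filtration Tg 0 1.
Proof.
by apply/filtrationP; exists 1; rewrite ?hornerC //; apply: poly_component1.
Qed.

(** The coefficients of an element of [T[z]^n] are the homogeneous components of its value at
    [z = 1], and the sum of the [Tg i] is direct. *)
Lemma horner1_inj n f g : poly_component Tg n f -> poly_component Tg n g ->
  f.[1] = g.[1] -> f = g.
Proof.
move=> hf hg fg; apply/eqP; rewrite -subr_eq0; apply/eqP.
have [c hc E] := subgroupB (poly_component_subgroup n) hf hg.
have : (f - g).[1] = 0 by rewrite hornerD hornerN fg subrr.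
rewrite -E horner1_homogenize => /(graded_direct hT hc) c0.
by apply: big1 => i _; rewrite c0 ?mul0r // -ltnS.
Qed.

(** * Homogeneous components of elements of [T] *)

Lemma truncated_family c n : homogeneous_family Tg c ->
  homogeneous_family Tg (fun i => if (i <= n)%N then c i else 0).
Proof. by move=> hc i; case: ifP => // _; apply: subgroup0. Qed.

Lemma sum_truncated c n m : (n <= m)%N ->
  \sum_(i < m.+1) (if (i <= n)%N then c i else 0) = \sum_(i < n.+1) c i.
Proof.
move=> nm; rewrite [RHS](big_ord_widen m.+1) ?ltnS // [RHS]big_mkcond /=.
by apply: eq_bigr => i _; rewrite ltnS.
Qed.

(** Asking for equality at all large bounds lets decompositions of several elements be compared at a
    common bound. *)
Lemma homogeneous_decomposition x : exists c, homogeneous_family Tg c /\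
  exists n, forall m, (n <= m)%N -> x = \sum_(i < m.+1) c i.
Proof.
have [n [c hc <-]] := graded_cover hT x.
exists (fun i => if (i <= n)%N then c i else 0); split.
  exact: truncated_family.
by exists n => m nm; rewrite sum_truncated.
Qed.

Definition component x : nat -> T :=
  proj1_sig (cid (homogeneous_decomposition x)).

Lemma component_homogeneous x : homogeneous_family Tg (component x).
Proof. by rewrite /component; case: cid => c []. Qed.

Lemma sum_component x :
  exists n, forall m, (n <= m)%N -> x = \sum_(i < m.+1) component x i.
Proof. by rewrite /component; case: cid => c []. Qed.

Lemma component_unique c n x :
  homogeneous_family Tg c -> (forall m, (n <= m)%N -> x = \sum_(i < m.+1) c i) ->
  component x =1 c.
Proof.
move=> hc xc i; have [n' xn'] := sum_component x.
(* Both sums up to this [m] equal [x], and [i <= m] lets directness apply at [i]. *)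
set m := maxn i (maxn n n'); apply/eqP; rewrite -subr_eq0; apply/eqP.
apply: (graded_direct hT (c := fun i => component x i - c i) (n := m)).
- by move=> j; apply: subgroupB => //; apply: component_homogeneous.
- by rewrite sumrB -xn' -?xc ?subrr // /m !leq_max leqnn !orbT.
- by rewrite /m leq_max leqnn.
Qed.

Lemma componentB i : zmod_morphism (component ^~ i).
Proof.
move=> x y; have [n xn] := sum_component x; have [m ym] := sum_component y.
apply: (component_unique (c := fun i => component x i - component y i)
  (n := maxn n m)) => [j|k]; first by apply: subgroupB => //; apply: component_homogeneous.
by rewrite geq_max sumrB => /andP[/xn <- /ym <-].
Qed.

Lemma component_of_homogeneous m x i :
  Tg m x -> component x i = if i == m then x else 0.
Proof.
move=> mx; apply: (component_unique (c := fun i => if i == m then x else 0) (n := m)).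
  by move=> j; case: eqP => [->//|_]; apply: subgroup0.
move=> k mk; have hm : (m < k.+1)%N by [].
rewrite (bigD1 (Ordinal hm)) //= eqxx big1 ?addr0 // => j.
by rewrite -val_eqE /= => /negPf ->.
Qed.

(* The value at [z = 1] of the degree-[n] component of [f]. *)
Definition component_at1 n f : T := \sum_(k < n.+1) component f`_k (n - k)%N.

Lemma component_at1B n : zmod_morphism (component_at1 n).
Proof.
move=> f g; rewrite /component_at1 -sumrB; apply: eq_bigr => k _.
by rewrite coefB componentB.
Qed.

(** For [k <= m] the coefficient of [z^k] lies in [Tg (m - k)], so its component of degree [n - k]
    is the whole coefficient if [n = m], and [0] otherwise. *)
Lemma component_at1_homogeneous m n f : poly_component Tg m f ->
  component_at1 n f = if n == m then f.[1] else 0.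
Proof.
move=> mf; have /poly_componentP hf := mf.
have comp0 i : component 0 i = 0.
  by rewrite (component_of_homogeneous _ (subgroup0 (TgA 0))); case: eqP.
case: eqP => [->|nm]; last first.
  apply: big1 => -[k /= kn] _; have := hf k.
  case: leqP => [km /component_of_homogeneous->|_ ->//].
  (* Since [k] is at most both [n] and [m], [n - k = m - k] forces [n = m]. *)
  case: eqP => // E; case: nm.
  by rewrite -(subnK km) -E subnK.
have [c hc E] := mf.
rewrite (horner_coef_wide _ (n := m.+1)); last first.
  by rewrite -E homogenizeE size_poly.
apply: eq_bigr => -[k /= km] _; have := hf k; rewrite -ltnS km.
by move/component_of_homogeneous=> ->; rewrite eqxx expr1n mulr1.
Qed.

(** Splitting each coefficient into homogeneous parts [c i] writes [f] as a sum of terms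
    [c i * z^k], of degree [i + k]. *)
Lemma homogeneous_add_span f :
  add_span [set g | exists n, poly_component Tg n g] f.
Proof.
have spanA := add_span_subgroup [set g | exists n, poly_component Tg n g].
rewrite -[f]coefK poly_def; apply: subgroup_sum => // k _.
have [n [c hc <-]] := graded_cover hT f`_k.
rewrite scaler_suml; apply: subgroup_sum => // i _.
apply: sub_add_span; exists (i + k)%N; apply/poly_componentP => j.
rewrite coefZ coefXn; case: eqP => [->|_].
  by rewrite leq_addl mulr1 addnK; apply: hc.
by rewrite mulr0; case: ifP => // _; apply: subgroup0.
Qed.

(** * The ideal generated by [P^*] and the subgroups [P_n] *)

Variable P : set T.

Local Notation I := (ideal_span (homogenizations Tg P)).

Lemma filtered_part_subgroup n : additive_subgroup (filtered_part Tg P n).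
Proof. exact: add_span_subgroup. Qed.

Lemma mem_filtered_part i j k a p b :
  filtration Tg i a -> P p -> filtration Tg j p -> filtration Tg k b ->
  filtered_part Tg P (i + j + k) (a * p * b).
Proof.
move=> ha Pp hp hb; apply: sub_add_span; exists i, j, k; split=> //.
by apply: mul_span_mul => //; apply: mul_span_mul.
Qed.

Lemma filtered_part_min n (A : set T) : additive_subgroup A ->
  (forall i j k a p b, (i + j + k)%N = n -> filtration Tg i a -> P p ->
    filtration Tg j p -> filtration Tg k b -> A (a * p * b)) ->
  filtered_part Tg P n `<=` A.
Proof.
move=> hA hgen; apply: add_span_min => // x [i [j [k [ijk]]]].
apply: add_span_min x => // _ [y hy [b hb <-]].
have hAb := preim_mulr_subgroup b hA.
apply: (add_span_min hAb) hy => _ [a ha [p [Pp hp] <-]] /=.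
exact: hgen ijk ha Pp hp hb.
Qed.

(** On generators, [a] is absorbed into the left outer factor. *)
Lemma filtered_part_mull m n a x : filtration Tg m a ->
  filtered_part Tg P n x -> filtered_part Tg P (m + n) (a * x).
Proof.
move=> ha; have hA := preim_mull_subgroup a (filtered_part_subgroup (m + n)).
apply: (filtered_part_min hA) => i j k b p b' <- hb Pp hp hb' /=.
rewrite !mulrA !addnA.
by apply: mem_filtered_part => //; apply: filtrationM.
Qed.

Lemma filtered_part_mulr m n a x : filtration Tg m a ->
  filtered_part Tg P n x -> filtered_part Tg P (n + m) (x * a).
Proof.
move=> ha; have hA := preim_mulr_subgroup a (filtered_part_subgroup (n + m)).
apply: (filtered_part_min hA) => i j k b p b' <- hb Pp hp hb' /=.
rewrite -[_ * b' * a]mulrA -addnA.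
by apply: mem_filtered_part => //; apply: filtrationM.
Qed.

(** An upper bound for the ideal generated by [P^*], spanned by homogeneous elements so that its
    degree-[n] part can be read off with [component_at1]. *)
Definition filtered_ideal : set {poly T} :=
  add_span [set f | exists2 n, poly_component Tg n f & filtered_part Tg P n f.[1]].

(** Multiplication is biadditive and homogeneous elements span [T[z]], so only homogeneous factors
    matter; for them degrees add and values at [z = 1] multiply. *)
Lemma filtered_ideal_ideal : two_sided_ideal filtered_ideal.
Proof.
have JA : additive_subgroup filtered_ideal by apply: add_span_subgroup.
split=> // r f hf; split.
  have hA := preim_mulr_subgroup f JA.
  apply: (add_span_min hA) (homogeneous_add_span r) => g [m hg] /=.
  apply: (add_span_min (preim_mull_subgroup g JA)) hf => h [n hh Ph] /=.
  apply: sub_add_span; exists (m + n)%N; first exact: poly_componentM.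
  by rewrite horner1M; apply: filtered_part_mull => //; apply/filtrationP; exists g.
have hA := preim_mull_subgroup f JA.
apply: (add_span_min hA) (homogeneous_add_span r) => g [m hg] /=.
apply: (add_span_min (preim_mulr_subgroup g JA)) hf => h [n hh Ph] /=.
apply: sub_add_span; exists (n + m)%N; first exact: poly_componentM.
by rewrite horner1M; apply: filtered_part_mulr => //; apply/filtrationP; exists g.
Qed.

Lemma ideal_span_sub_filtered_ideal : I `<=` filtered_ideal.
Proof.
move=> f; apply; split; first exact: filtered_ideal_ideal.
move=> q [p Pp [[_ ->]|[c [d [hc _ pE ->]]]]].
  by apply: subgroup0; apply: add_span_subgroup.
apply: sub_add_span; exists d; first by exists c.
(* The value [p = 1 * p * 1] is a generator of [P_d] with [i = k = 0] and [j = d]. *)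
rewrite horner1_homogenize -pE -[p]mul1r -[1 * p]mulr1 -[d]add0n -[(0 + d)%N]addn0.
apply: mem_filtered_part => //; try exact: filtration1.
by exists c.
Qed.

(** If the top terms of [c] vanish, [homogenize c n] is not [x^*] but [x^*] times a power of [z],
    still in the ideal; the induction strips off these powers. *)
Lemma homogenize_in_ideal c n : homogeneous_family Tg c ->
  P (\sum_(i < n.+1) c i) -> I (homogenize c n).
Proof.
move=> hc; elim: n => [|n IH] Pc.
  have [c0|c0] := eqVneq (c 0) 0.
    rewrite /homogenize big_ord1 c0 mul0r.
    exact: subgroup0 (ideal_span_subgroup _).
  by apply: sub_ideal_span; exists (\sum_(i < 1) c i) => //; right; exists c, 0.
have [c0|c0] := eqVneq (c n.+1) 0; last first.
  apply: sub_ideal_span; exists (\sum_(i < n.+2) c i) => //.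
  by right; exists c, n.+1.
have -> : homogenize c n.+1 = homogenize c n * 'X.
  rewrite /homogenize big_ord_recr /= c0 mul0r addr0 big_distrl /=.
  by apply: eq_bigr => i _; rewrite subSn ?exprSr ?mulrA // -ltnS.
apply: ideal_span_mulr; apply: IH.
by move: Pc; rewrite big_ord_recr /= c0 addr0.
Qed.

Lemma mem_ideal_homogeneous n f : poly_component Tg n f ->
  I f <-> filtered_part Tg P n f.[1].
Proof.
move=> hf; split=> [/ideal_span_sub_filtered_ideal|].
  (* The additive map [component_at1 n] sends a generator of degree [n] to its value in [P_n] and
     any other generator to [0]; so it sends [f] to [f(1)] in [P_n]. *)
  have hA := preim_subgroup (@component_at1B n) (filtered_part_subgroup n).
  move/(add_span_min hA); rewrite /preimage /= (component_at1_homogeneous n hf) eqxx.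
  apply=> g [m hg Pg] /=; rewrite (component_at1_homogeneous n hg).
  by case: eqP => [->//|_]; apply: subgroup0; apply: filtered_part_subgroup.
(* Conversely, once [f(1)] is the value of some degree-[n] element of the ideal, injectivity of
   evaluation on [T[z]^n] identifies that element with [f]. *)
pose A := [set x | exists g, [/\ poly_component Tg n g, I g & g.[1] = x]].
suff /[apply] : filtered_part Tg P n `<=` A.
  by move=> [g [hg Ig /(horner1_inj hg hf) <-]].
have IA := ideal_span_subgroup (homogenizations Tg P).
have cA := poly_component_subgroup n.
apply: filtered_part_min.
  split; first by exists 0; split; rewrite ?horner0 //; [exact: subgroup0 cA|exact: subgroup0 IA].
  move=> _ _ [g [hg Ig <-]] [h [hh Ih <-]]; exists (g - h).
  split; [exact: subgroupB cA hg hh|exact: subgroupB IA Ig Ih|].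
  by rewrite hornerD hornerN.
move=> i j k _ p _ ijk /filtrationP[a ha <-] Pp [c hc pE] /filtrationP[b hb <-].
(* Homogenizing [p] in degree [j], even when its actual degree is smaller, makes the total degree
   exactly [n]. *)
exists (a * homogenize c j * b); split.
- rewrite -ijk; apply: (poly_componentM _ hb); apply: (poly_componentM ha).
  by exists c.
- apply: ideal_span_mulr; apply: ideal_span_mull.
  by apply: homogenize_in_ideal => //; rewrite pE.
- by rewrite !horner1M horner1_homogenize pE.
Qed.

(** Multiplication by [z] raises the degree by one and keeps the value at [z = 1]. *)
Lemma ext_z_mul_eq0 n f : poly_component Tg n f ->
  ext_z Tg P * to_central_extension Tg P f = 0 <->
  filtered_part Tg P n.+1 f.[1].
Proof.
move=> hf; have hXf := poly_componentM poly_componentX hf.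
have E : ('X * f).[1] = f.[1] by rewrite horner1M hornerX mul1r.
rewrite -E -[n.+1]/(1 + n)%N -(mem_ideal_homogeneous hXf) -class_of_eq0.
by rewrite /ext_z /to_central_extension rmorphM.
Qed.

End Graded.

Theorem theorem2p23 (S T : nzRingType) (iota : {rmorphism S -> T})
    (Tg : nat -> set T) (hT : graded_over iota Tg)
    (hconn : connected_grading iota Tg) (hstrong : strongly_graded Tg)
    (P : set T) (hP : subbimodule iota P) (n : nat) :
  filtered_part Tg P n.+1 `&` filtration Tg n `<=` filtered_part Tg P n <->
  ann_z_component Tg P n = [set 0].
Proof.
split=> [jacobi|ann0 x [Px /filtrationP[f hf fx]]].
  apply/seteqP; split=> [a [za [f hf fa]]|_ ->] /=.
    move: za; rewrite /ann_z /= -fa => /(ext_z_mul_eq0 hT P hf) Pf.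
    apply/class_of_eq0/(mem_ideal_homogeneous hT P hf).
    apply: jacobi; split=> //.
    by apply/filtrationP; exists f.
  split; first by rewrite /ann_z /= mulr0.
  exists 0; first by apply: subgroup0; apply: poly_component_subgroup hT n.
  exact: raddf0.
(* The lift [f] of [x] to [T[z]^n] represents an element killed by [z], because [x] lies in
   [P_{n+1}]. *)
have : ann_z_component Tg P n (to_central_extension Tg P f).
  by split; [apply/(ext_z_mul_eq0 hT P hf); rewrite fx|exists f].
rewrite ann0 -fx => /class_of_eq0.
by move/(mem_ideal_homogeneous hT P hf).
Qed.
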